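(* Let the decay factor $\alpha\in(0,1)$, the relative error parameter $c\in(0,\tfrac12)$ and the failure probability $p_f\in(0,1)$ be constants. In the arc-centric graph query model there is a randomized algorithm (called RoundWalks) with the following guarantees. (a) For every directed graph $G$, every source node $s$ and every $\varepsilon\in(0,1)$, it solves the SSPPR-A query (that is, it outputs a vector $\hat\pi(s,\cdot)$ such that with probability at least $1-p_f$ one has $|\hat\pi(s,t)-\pi(s,t)|\le\varepsilon$ for all nodes $t$) within $O(1/\varepsilon^2)$ queries in expectation. (b) For every directed graph $G$, every source node $s$ and every $\delta\in(0,1)$, it solves the SSPPR-R query (that is, it outputs a vector $\hat\pi(s,\cdot)$ such that with probability at least $1-p_f$ one has $|\hat\pi(s,t)-\pi(s,t)|\le c\cdot\pi(s,t)$ for all nodes $t$ with $\pi(s,t)\ge\delta$) within $O(\log(1/\delta)/\delta)$ queries in expectation.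
   Context: Personalized PageRank (PPR): for a directed graph $G$ and decay factor $\alpha\in(0,1)$, an $\alpha$-decay random walk from $s$ at each step stops at the current node with probability $\alpha$, and with probability $1-\alpha$ moves to a uniformly random out-neighbour of the current node. $\pi(s,t)$ is the probability that the walk started at $s$ terminates at $t$. It is assumed, without loss of generality, that the graph has no dangling nodes (nodes without out-neighbours). Output vectors may be given sparsely (unspecified entries are $0$). The parameters $\alpha,c,p_f$ are treated as constants in the $O$-notation. Arc-centric graph query model: nodes carry labels in $\{1,\dots,|V|\}$; the out-edges (in-edges) of a node $v$ are indexed by $1,\dots,d_{out}(v)$ (resp. $1,\dots,d_{in}(v)$). The algorithm is given $s$ (which is covered) and accesses $G$ only via unit-cost queries: JUMP() returns a uniformly random node and marks it covered; INDEG$(v)$/OUTDEG$(v)$ return the in-/out-degree of a covered node $v$; ADJ$_{in}(v,i)$/ADJ$_{out}(v,i)$ return the $i$-th in-/out-neighbour of a covered node $v$ (which then becomes covered). *)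

(* Defs.v *)
From mathcomp Require Import all_boot all_order all_algebra.
From mathcomp Require Import finmap.
From mathcomp Require Import all_classical all_reals all_analysis.

Set Implicit Arguments.
Unset Strict Implicit.
Unset Printing Implicit Defensive.

Import Order.TTheory GRing.Theory Num.Theory.
Import numFieldNormedType.Exports.

Local Open Scope classical_set_scope.
Local Open Scope ring_scope.

(* The nodes are 'I_nb_nodes and the label of v is its value as a natural
   number, so labels and arc indices are counted from 0 instead of 1.
   The arc indexing seen by the queries is part of the graph, hence arbitrary:
   out_nbrs v and in_nbrs v list the out- and in-neighbours of v in index
   order. *)
Record digraph := Digraph {
  nb_nodes : nat;
  arc : rel 'I_nb_nodes;
  out_nbrs : 'I_nb_nodes -> seq 'I_nb_nodes;
  in_nbrs : 'I_nb_nodes -> seq 'I_nb_nodes;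
  out_nbrsP : forall v, perm_eq (out_nbrs v) (enum [pred w | arc v w]);
  in_nbrsP : forall v, perm_eq (in_nbrs v) (enum [pred u | arc u v])
}.

Notation node G := 'I_(nb_nodes G).

Definition outdeg (G : digraph) (v : node G) : nat := #|[pred w | arc v w]|.
Definition indeg (G : digraph) (v : node G) : nat := #|[pred u | arc u v]|.

Definition no_dangling (G : digraph) : Prop :=
  forall v : node G, exists w, arc v w.

Section PersonalizedPageRank.
Context {R : realType}.
Variables (alpha : R) (G : digraph) (s : node G).

(* Probability that the alpha-decay walk from s makes at least k moves and is
   at v right after the k-th one. *)
Fixpoint walk_at (k : nat) (v : node G) : R :=
  if k is k'.+1 then
    \sum_(u | arc u v) walk_at k' u * ((1 - alpha) * (outdeg u)%:R^-1)
  else (v == s)%:R.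

(* alpha * walk_at k t is the probability that the walk stops at t after
   exactly k moves; these events are disjoint. *)
Definition ppr (t : node G) : R :=
  limn (series (fun k => alpha * walk_at k t)).

End PersonalizedPageRank.

Section QueryModel.
Variable R : realType.

Record fdist (k : nat) := FDist {
  fdist_fun :> 'I_k -> R;
  fdist_ge0 : forall i, 0 <= fdist_fun i;
  fdist_sum1 : \sum_(i < k) fdist_fun i = 1
}.

(* Nodes are designated by their labels. *)
Inductive query :=
  | JUMP
  | INDEG of nat
  | OUTDEG of nat
  | ADJin of nat & nat
  | ADJout of nat & nat.

(* Output vectors: finitely supported functions of the label. *)
Definition svec := {fsfun nat -> R with 0}.

(* One action of an algorithm: a free internal random draw from a finite
   distribution, a unit-cost query, or termination with an output. *)
Inductive action :=
  | Draw (k : nat) of fdist k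
  | Ask of query
  | Output of svec.

(* A randomized algorithm chooses its next action from the sequence of the
   results of all its previous draws and queries (oldest first).  It has no
   other access to the graph. *)
Definition algorithm := seq nat -> action.

Section Execution.
Variable G : digraph.
Implicit Types C : {set node G}.

Definition covered_node C (l : nat) : option (node G) :=
  [pick v in C | val v == l].

(* Answer to a query other than JUMP together with the new set of covered
   nodes, or None if the query is illegal: its node is not covered, or the arc
   index is out of range. *)
Definition reply C (q : query) : option (nat * {set node G}) :=
  match q with
  | JUMP => None
  | INDEG l => omap (fun v => (indeg v, C)) (covered_node C l)
  | OUTDEG l => omap (fun v => (outdeg v, C)) (covered_node C l)
  | ADJin l i =>
      obind (fun v => omap (fun u => (val u, u |: C)%SET) (onth (in_nbrs v) i))
            (covered_node C l)
  | ADJout l i =>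
      obind (fun v => omap (fun w => (val w, w |: C)%SET) (onth (out_nbrs v) i))
            (covered_node C l)
  end.

(* Expectation of f (number of queries made) (output, if any) when A is run
   for at most k more actions, having made m queries, with past results h and
   covered nodes C.  An illegal query ends the run without an output. *)
Fixpoint run (A : algorithm) (f : nat -> option svec -> R)
    (k m : nat) (h : seq nat) C : R :=
  if k is k'.+1 then
    match A h with
    | Output x => f m (Some x)
    | Draw p mu => \sum_(i < p) mu i * run A f k' m (rcons h i) C
    | Ask JUMP =>
        \sum_(v : node G)
          (nb_nodes G)%:R^-1 * run A f k' m.+1 (rcons h v) (v |: C)%SET
    | Ask q =>
        if reply C q is Some (a, C') then run A f k' m.+1 (rcons h a) C'
        else f m.+1 None
    end
  else f m None.

(* In both definitions below the truncated expectations are nondecreasing in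
   the number k of actions, so that their supremum is their limit, namely the
   value for the complete, possibly infinite, run (monotone convergence). *)
Definition pr_output (A : algorithm) (s : node G) (E : pred svec) : \bar R :=
  ereal_sup (range (fun k =>
    (run A (fun _ o => if o is Some x then (E x)%:R else 0)
       k 0 [::] [set s]%SET)%:E)).

Definition expected_queries (A : algorithm) (s : node G) : \bar R :=
  ereal_sup (range (fun k =>
    (run A (fun m _ => m%:R) k 0 [::] [set s]%SET)%:E)).

End Execution.

Inductive ssppr_query :=
  | SSPPR_A of R
  | SSPPR_R of R.

(* Correctness of an output vector; c is only used by SSPPR_R. *)
Definition ssppr_correct (alpha c : R) (Q : ssppr_query)
    (G : digraph) (s : node G) (x : svec) : bool :=
  match Q with
  | SSPPR_A eps =>
      [forall t : node G, `|x (val t) - ppr alpha s t| <= eps]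
  | SSPPR_R delta =>
      [forall t : node G, (delta <= ppr alpha s t) ==>
         (`|x (val t) - ppr alpha s t| <= c * ppr alpha s t)]
  end.

(* A outputs a vector with probability 1, and a correct one with probability
   at least 1 - pf. *)
Definition solves (alpha c pf : R) (Q : ssppr_query)
    (G : digraph) (s : node G) (A : algorithm) : Prop :=
  pr_output A s predT = 1%:E /\
  ((1 - pf)%:E <= pr_output A s (ssppr_correct alpha c Q s))%E.

End QueryModel.

(* Main.v *)
Require Import Defs.
From mathcomp Require Import all_boot all_order all_algebra.
From mathcomp Require Import finmap ring lra.
From mathcomp Require Import all_classical all_reals all_analysis.
Import Order.TTheory GRing.Theory Num.Theory.
Import numFieldNormedType.Exports.

Set Implicit Arguments.
Unset Strict Implicit.
Unset Printing Implicit Defensive.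

Local Open Scope classical_set_scope.
Local Open Scope ring_scope.

(* Monte Carlo: return the frequencies of the end points of n independent
   walks.  The number of moves of a walk is drawn first, from the geometric law
   truncated at L; this changes each stopping probability by at most
   (1 - alpha)^L, and a walk still costs at most 2/alpha queries on average.

   For the absolute error, the expected squared l2 distance between the
   frequencies and their law is at most 1/n, whatever the number of nodes, so
   that n = O(1/eps^2) suffices by Markov's inequality.  For the relative error,
   a Chernoff bound applies to each node, and at most 1/b nodes have probability
   at least b, so that n = O(log(1/delta)/delta) suffices by a union bound. *)

(** * Tail bounds for the empirical frequencies of independent draws *)

Section IidMean.
Context {R : realType} {T : finType}.
Variable q : T -> R.

(** Nested finite sums encode independence without a product measure, and follow the recursion of
    [walks_prog]. *)
Fixpoint iid_mean (n : nat) (F : seq T -> R) : R :=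
  if n is n'.+1 then \sum_t q t * iid_mean n' (fun w => F (t :: w)) else F [::].

Lemma eq_iid_mean n F F' : F =1 F' -> iid_mean n F = iid_mean n F'.
Proof.
elim: n F F' => [|n IH] F F' FF' /=; first exact: FF'.
by apply: eq_bigr => t _; congr (_ * _); apply: IH => w; apply: FF'.
Qed.

Lemma iid_meanZ n a F : iid_mean n (fun w => a * F w) = a * iid_mean n F.
Proof.
elim: n F => [|n IH] F //=; rewrite big_distrr /=.
by apply: eq_bigr => t _; rewrite IH mulrCA.
Qed.

Lemma iid_meanD n F F' :
  iid_mean n (fun w => F w + F' w) = iid_mean n F + iid_mean n F'.
Proof.
elim: n F F' => [|n IH] F F' //=; rewrite -big_split /=.
by apply: eq_bigr => t _; rewrite IH mulrDr.
Qed.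

Lemma iid_mean_sum (I : finType) (P : pred I) n (F : I -> seq T -> R) :
  iid_mean n (fun w => \sum_(i | P i) F i w) = \sum_(i | P i) iid_mean n (F i).
Proof.
elim: n F => [|n IH] F //=; rewrite exchange_big /=.
by apply: eq_bigr => t _; rewrite IH big_distrr.
Qed.

Hypothesis q_ge0 : forall t, 0 <= q t.

Lemma ler_iid_mean n F F' :
  (forall w, F w <= F' w) -> iid_mean n F <= iid_mean n F'.
Proof.
elim: n F F' => [|n IH] F F' FF' /=; first exact: FF'.
by apply: ler_sum => t _; apply: ler_wpM2l => //; apply: IH => w; apply: FF'.
Qed.

Hypothesis q_sum1 : \sum_t q t = 1.

Lemma iid_mean_cst n a : iid_mean n (fun=> a) = a.
Proof.
elim: n => [|n IH] //=.
by under eq_bigr do rewrite IH; rewrite -big_distrl /= q_sum1 mul1r.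
Qed.

Lemma sum_split_at t a b : \sum_u q u * (if u == t then a else b) =
  q t * a + (1 - q t) * b.
Proof.
rewrite (bigD1 t) //= eqxx; congr (_ + _).
rewrite (eq_bigr (fun u => q u * b)) => [|u /negbTE -> //].
by rewrite -big_distrl /= -q_sum1 [X in (X - _) * _](bigD1 t) //= addrC addrK.
Qed.

Lemma iid_mean_count_exp n t (l : R) :
  iid_mean n (fun w => expR (l * (count_mem t w)%:R)) =
  (1 + q t * (expR l - 1)) ^+ n.
Proof.
elim: n => [|n IH] /=; first by rewrite mulr0 expR0.
rewrite -[RHS]/(_ ^+ _.+1) exprS -IH.
rewrite (eq_bigr (fun u => q u * (if u == t then
    expR l * iid_mean n (fun w => expR (l * (count_mem t w)%:R))
    else iid_mean n (fun w => expR (l * (count_mem t w)%:R))))) => [|u _].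
  by rewrite sum_split_at; ring.
congr (_ * _); case: eqP => _; last exact: eq_iid_mean.
rewrite -iid_meanZ; apply: eq_iid_mean => w.
by rewrite natrD mulrDr mulr1 expRD.
Qed.

(** This is the binomial variance. The offset x makes the induction work: the first draw moves it by
    [1 - q t] or by [- q t]. *)
Lemma iid_mean_count_sqr n t (x : R) :
  iid_mean n (fun w => (x + (count_mem t w)%:R - n%:R * q t) ^+ 2) =
  x ^+ 2 + n%:R * (q t * (1 - q t)).
Proof.
elim: n x => [|n IH] x /=; first by rewrite !mul0r addr0 subr0 addr0.
rewrite (eq_bigr (fun u => q u * (if u == t then
    (x + 1 - q t) ^+ 2 + n%:R * (q t * (1 - q t))
    else (x - q t) ^+ 2 + n%:R * (q t * (1 - q t))))) => [|u _].
  by rewrite sum_split_at -natr1; ring.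
by congr (_ * _); case: eqP => _; rewrite -IH; apply: eq_iid_mean => w;
  rewrite -natr1 ?natrD /=; ring.
Qed.

(** Markov's inequality for the sum over all t of the squared deviations of the counts: its mean is
    at most n because q sums to 1, and one large deviation already brings it to (n a)^2. *)
Lemma second_moment_tail n (a : R) : (0 < n)%N -> 0 < a ->
  iid_mean n (fun w =>
    [exists t, a < `|(count_mem t w)%:R / n%:R - q t|]%:R)
  <= (n%:R * a ^+ 2)^-1.
Proof.
move=> n0 a0; have n0' : 0 < n%:R :> R by rewrite ltr0n.
set V := fun w t => (0 + (count_mem t w)%:R - n%:R * q t) ^+ 2.
apply: (@le_trans _ _ (iid_mean n (fun w =>
    ((n%:R * a) ^+ 2)^-1 * \sum_t V w t))); last first.
  rewrite iid_meanZ iid_mean_sum.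
  under eq_bigr do rewrite iid_mean_count_sqr expr0n add0r.
  have le1 : \sum_t n%:R * (q t * (1 - q t)) <= n%:R.
    rewrite -big_distrr /= -[leRHS]mulr1 ler_pM2l // -q_sum1.
    by apply: ler_sum => t _; rewrite q_sum1 ler_piMr // gerBl.
  apply: (@le_trans _ _ (((n%:R * a) ^+ 2)^-1 * n%:R)).
    by rewrite ler_pM2l // invr_gt0 exprn_gt0 // mulr_gt0.
  rewrite le_eqVlt; apply/orP; left; apply/eqP; field.
  by rewrite !gt_eqF.
apply: ler_iid_mean => w; rewrite mulrC.
have V_ge0 t : 0 <= V w t by exact: sqr_ge0.
case: existsP => [[t at_]|_]; last first.
  by rewrite divr_ge0 ?sumr_ge0 // exprn_ge0 // mulr_ge0 // ltW.
rewrite /= ler_pdivlMr ?exprn_gt0 ?mulr_gt0 // mul1r (bigD1 t) //=.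
apply: ler_wpDr; first exact: sumr_ge0.
rewrite /V -[leRHS]real_normK ?num_real //.
rewrite ler_pXn2r ?nnegrE ?mulr_ge0 ?(ltW a0) //.
have -> : 0 + (count_mem t w)%:R - n%:R * q t =
    n%:R * ((count_mem t w)%:R / n%:R - q t).
  by field; rewrite gt_eqF.
by rewrite normrM gtr0_norm // ler_pM2l // ltW.
Qed.

(** From 1 - x <= exp(-x) follows exp(x) <= 1/(1 - x), and (1 - x)(1 + x + 2x^2) = 1 + x^2(1 - 2x)
    >= 1. *)
Lemma expR_le_quad (x : R) : x <= 2^-1 -> expR x <= 1 + x + 2 * x ^+ 2.
Proof.
move=> x2; have := expR_ge1Dx (- x); rewrite expRN => h.
have e0 := expR_gt0 x.
have : (1 - x) * expR x <= 1 by rewrite -ler_pdivlMr // div1r.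
move=> h1; have {}h1 : expR x <= (1 - x)^-1.
  by rewrite -[leRHS]div1r ler_pdivlMr; [rewrite mulrC|lra].
apply: (le_trans h1); rewrite -[leLHS]div1r ler_pdivrMr; last lra.
have := sqr_ge0 x; nra.
Qed.

(* The exponential moment at l = a/4 and l = -a/4 bounds the two tails. *)
Lemma chernoff n t (a : R) : (0 < n)%N -> 0 < a <= 1 ->
  iid_mean n (fun w => (a * q t < `|(count_mem t w)%:R / n%:R - q t|)%R%:R)
  <= 2 * expR (- (n%:R * q t * a ^+ 2 / 8)).
Proof.
move=> n0 /andP[a0 a1]; have n0' : 0 < n%:R :> R by rewrite ltr0n.
(* [tail l] is at least 1 when the deviation occurs on the side given by the sign of l. Its mean is
   at most exp(n q (2 l^2 - |l| a)), and |l| = a/4 minimizes this. *)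
pose tail (l : R) w :=
  expR (- (n%:R * q t * (l + `|l| * a))) * expR (l * (count_mem t w)%:R).
have tailP l : `|l| = a / 4 ->
    iid_mean n (tail l) <= expR (- (n%:R * q t * a ^+ 2 / 8)).
  move=> la; rewrite iid_meanZ iid_mean_count_exp la.
  have l2 : l ^+ 2 = (a / 4) ^+ 2 by rewrite -la real_normK ?num_real.
  have hb : expR l <= 1 + l + 2 * l ^+ 2.
    by apply: expR_le_quad; apply: (le_trans (ler_norm l)); rewrite la; lra.
  have : (1 + q t * (expR l - 1)) ^+ n <= expR (q t * (l + 2 * l ^+ 2)) ^+ n.
    have q1 : q t <= 1.
      by rewrite -q_sum1 (bigD1 t) //= lerDl sumr_ge0.
    have := expR_gt0 l => e0; have := q_ge0 t => qt0.
    have p0 : 0 <= 1 + q t * (expR l - 1) by nra.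
    rewrite lerXn2r ?nnegrE ?expR_ge0 //.
    apply: le_trans (expR_ge1Dx _); rewrite lerD2l ler_wpM2l //; lra.
  rewrite -expRM_natl => h.
  apply: (le_trans (ler_wpM2l (expR_ge0 _) h)).
  rewrite -expRD ler_expR l2 le_eqVlt; apply/orP; left; apply/eqP.
  by field.
have -> : forall e : R, 2 * e = e + e by move=> e; ring.
have a4 : `|a / 4| = a / 4 by rewrite gtr0_norm // divr_gt0.
apply: le_trans (lerD (tailP (a / 4) _) (tailP (- (a / 4)) _));
  rewrite ?normrN //.
rewrite -iid_meanD; apply: ler_iid_mean => w; rewrite /tail normrN a4 -!expRD.
case: ltP => h; last by rewrite addr_ge0 ?expR_ge0.
set k := (count_mem t w)%:R in h *.
have kE : k = n%:R * (k / n%:R) by field; rewrite gt_eqF.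
have step (x y : R) : 0 <= x -> 1 <= expR x + expR y.
  by move=> x0; apply: ler_wpDr; rewrite ?expR_ge0 // -expR0 ler_expR.
have naq := mulr_gt0 n0' a0.
move: h; rewrite lter_normr => /orP[] h; last rewrite addrC; apply: step.
- have -> : - (n%:R * q t * (a / 4 + a / 4 * a)) + a / 4 * k =
    n%:R * a / 4 * (k / n%:R - q t - a * q t) by field; rewrite gt_eqF.
  by rewrite mulr_ge0 ?divr_ge0 ?ltW // subr_gt0.
- have -> : - (n%:R * q t * (- (a / 4) + a / 4 * a)) + - (a / 4) * k =
    n%:R * a / 4 * (- (k / n%:R - q t) - a * q t) by field; rewrite gt_eqF.
  by rewrite mulr_ge0 ?divr_ge0 ?ltW // subr_gt0.
Qed.

(* At most 1/b values t have [q t >= b], hence the factor 1/b in the union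
   bound. *)
Lemma relative_tail n (a b : R) : (0 < n)%N -> 0 < a <= 1 -> 0 < b ->
  iid_mean n (fun w => [exists (t | b <= q t),
     a * q t < `|(count_mem t w)%:R / n%:R - q t|]%:R)
  <= 2 / b * expR (- (n%:R * b * a ^+ 2 / 8)).
Proof.
move=> n0 a01 b0; have n0' : 0 < n%:R :> R by rewrite ltr0n.
set D := fun t w => (a * q t < `|(count_mem t w)%:R / n%:R - q t|)%R.
apply: (@le_trans _ _ (iid_mean n (fun w => \sum_(t | b <= q t) (D t w)%:R))).
  apply: ler_iid_mean => w; case: existsP => [[t /andP[bt Dt]]|_]; last first.
    exact: sumr_ge0.
  by rewrite (bigD1 t) //= -/(D t w) in Dt *; rewrite Dt lerDl sumr_ge0.
rewrite iid_mean_sum.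
set e := expR _.
(* Weighting each term by [q t / b >= 1] yields the factor 1/b after summation, without counting the
   values t. *)
apply: (@le_trans _ _ (\sum_(t | b <= q t) 2 / b * e * q t)).
  apply: ler_sum => t bt; apply: (le_trans (chernoff _ n0 a01)).
  have -> : 2 / b * e * q t = 2 * (e * (q t / b)) by field; rewrite gt_eqF.
  rewrite ler_pM2l // -[leLHS]mulr1 ler_pM ?expR_ge0 //.
    rewrite ler_expR lerN2 ler_pM2r // ler_wpM2r ?sqr_ge0 // ler_pM2l //.
  by rewrite ler_pdivlMr // mul1r.
rewrite -big_distrr /= -[leRHS]mulr1 ler_wpM2l //.
  by rewrite !mulr_ge0 ?expR_ge0 ?invr_ge0 ?(ltW b0).
rewrite -q_sum1 [leRHS](bigID (fun t => b <= q t)) /=.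
by rewrite lerDl sumr_ge0.
Qed.

End IidMean.

(** * Finite decision trees and their execution as algorithms *)

Section Programs.
Variable R : realType.

(* Decision trees of finite depth: unlike an [algorithm], a program can be
   built and analysed by recursion. *)
Inductive prog :=
  | Ret of svec R
  | PDraw (k : nat) of fdist R k & (nat -> prog)
  | PAsk of query & (nat -> prog).

(** An algorithm sees only the list of past results, so the tree is replayed from its root at each
    action. *)
Fixpoint prog_action (p : prog) (h : seq nat) : action R :=
  match p, h with
  | Ret x, _ => Output x
  | PDraw _ mu _, [::] => Draw mu
  | PAsk q _, [::] => Ask _ q
  | PDraw _ _ F, a :: h' => prog_action (F a) h'
  | PAsk _ F, a :: h' => prog_action (F a) h'
  end.

Section Semantics.
Variable G : digraph.
Implicit Types (C : {set node G}) (f : nat -> option (svec R) -> R).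

Fixpoint prog_mean (p : prog) f (m : nat) C : R :=
  match p with
  | Ret x => f m (Some x)
  | PDraw k mu F => \sum_(i < k) mu i * prog_mean (F i) f m C
  | PAsk JUMP F =>
      \sum_(v : node G)
        (nb_nodes G)%:R^-1 * prog_mean (F v) f m.+1 (v |: C)%SET
  | PAsk q F =>
      if reply C q is Some (a, C') then prog_mean (F a) f m.+1 C'
      else f m.+1 None
  end.

(** [run] extends the history but never changes the algorithm, so inductions on a tree must speak of
    the subtree reached after h. *)
Definition follows (A : algorithm R) h p :=
  forall h', A (h ++ h') = prog_action p h'.

Lemma follows_draw A h k (mu : fdist R k) F a :
  follows A h (PDraw mu F) -> follows A (rcons h a) (F a).
Proof. by move=> Ah h'; rewrite cat_rcons Ah. Qed.

Lemma follows_ask A h q F a :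
  follows A h (PAsk q F) -> follows A (rcons h a) (F a).
Proof. by move=> Ah h'; rewrite cat_rcons Ah. Qed.

Lemma follows_nil A h p : follows A h p -> A h = prog_action p [::].
Proof. by move/(_ [::]); rewrite cats0. Qed.

(** Branching is finite, so budgets sufficient for the subtrees have a common bound; the filter at
    infinity supplies it without computing the depth. *)
Lemma run_prog_near p A f m h C : follows A h p ->
  \forall k \near \oo, run A f k m h C = prog_mean p f m C.
Proof.
elim: p m h C => [x|k mu F IH|q F IH] m h C Ah; apply: near_inftyS.
- by apply: nearW => k /=; rewrite (follows_nil Ah).
- have := filter_forall eventually_filter (fun i : 'I_k =>
    IH i m _ C (follows_draw i Ah)).
  move=> Hn; apply: (@filterS _ _ eventually_filter) Hn => k' H.
  rewrite /= (follows_nil Ah) /=.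
  by apply: eq_bigr => i _; rewrite H.
- have H1 q' : \forall k \near \oo,
      (if reply C q' is Some (a, C') then run A f k m.+1 (rcons h a) C'
       else f m.+1 None) =
      (if reply C q' is Some (a, C') then prog_mean (F a) f m.+1 C'
       else f m.+1 None).
    case: (reply C q') => [[a C']|]; last exact: nearW.
    exact: IH (follows_ask a Ah).
  have A0 := follows_nil Ah.
  case: q A0 Ah => [|l|l|l i|l i] A0 Ah; last 4 first.
  - by apply: filterS (H1 (INDEG l)) => k; rewrite /= A0.
  - by apply: filterS (H1 (OUTDEG l)) => k; rewrite /= A0.
  - by apply: filterS (H1 (ADJin l i)) => k; rewrite /= A0.
  - by apply: filterS (H1 (ADJout l i)) => k; rewrite /= A0.
  have := filter_forall eventually_filter (fun v : node G =>
    IH v m.+1 _ (v |: C)%SET (follows_ask v Ah)).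
  move=> Hn; apply: (@filterS _ _ eventually_filter) Hn => k H; rewrite /= A0 /=.
  by apply: eq_bigr => v _; rewrite H.
Qed.

Lemma run_prog p f :
  exists k, forall C, run (prog_action p) f k 0 [::] C = prog_mean p f 0 C.
Proof.
have := filter_forall eventually_filter (fun C : {set node G} =>
  @run_prog_near p (prog_action p) f 0 [::] C (fun=> erefl)).
by case=> k _ kP; exists k => C; apply: kP => /=.
Qed.

(** The node s witnesses that the graph is nonempty. *)
Lemma sum_inv_nodes (s : node G) : \sum_(v : node G) (nb_nodes G)%:R^-1 = 1 :> R.
Proof.
rewrite sumr_const card_ord -[_ *+ _]mulr_natl mulfV // pnatr_eq0 -lt0n.
exact: leq_trans (ltn_ord s).
Qed.

Lemma run_le1 (s : node G) A f k m h C : (forall m o, f m o <= 1) ->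
  run A f k m h C <= 1.
Proof.
move=> f1; elim: k m h C => [|k IH] m h C //=.
case: (A h) => [p mu|q|x] //.
  rewrite -(fdist_sum1 mu); apply: ler_sum => i _.
  by apply: ler_piMr; [exact: fdist_ge0 | exact: IH].
case: q => [|l|l|l i|l i]; last 4 first.
- by case: reply => [[]|].
- by case: reply => [[]|].
- by case: reply => [[]|].
- by case: reply => [[]|].
rewrite -[leRHS](sum_inv_nodes s); apply: ler_sum => v _.
by rewrite ler_piMr ?invr_ge0.
Qed.

Definition nb_asked (m : nat) (_ : option (svec R)) : R := m%:R.

Lemma prog_mean_asked_ge (s : node G) p m C : m%:R <= prog_mean p nb_asked m C.
Proof.
elim: p m C => [x|k mu F IH|q F IH] m C //=.
  rewrite -[leLHS]mul1r -{1}(fdist_sum1 mu) big_distrl /=; apply: ler_sum => i _.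
  by apply: ler_wpM2l; [exact: fdist_ge0 | exact: IH].
have mS : m%:R <= m.+1%:R :> R by rewrite ler_nat.
have leq' n C' : m%:R <= prog_mean (F n) nb_asked m.+1 C'.
  by exact: le_trans (IH _ _ _).
have H q' : m%:R <= (if reply C q' is Some (a, C') then
   prog_mean (F a) nb_asked m.+1 C' else nb_asked m.+1 None).
  by case: reply => [[]|].
case: q => [|l|l|l i|l i]; try exact: H.
rewrite -[leLHS]mul1r -{1}(sum_inv_nodes s) big_distrl /=; apply: ler_sum => v _.
by rewrite ler_wpM2l ?invr_ge0.
Qed.

(** Cutting a run short can only lose queries. Since [expected_queries] is a supremum over budgets,
    this bound at every budget suffices. *)
Lemma run_asked_le (s : node G) p A k m h C : follows A h p ->
  run A nb_asked k m h C <= prog_mean p nb_asked m C.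
Proof.
elim: p k m h C => [x|n mu F IH|q F IH] [|k] m h C Ah;
  try exact: prog_mean_asked_ge; have A0 := follows_nil Ah; rewrite /= A0 //=.
  apply: ler_sum => i _; apply: ler_wpM2l; first exact: fdist_ge0.
  exact: IH (follows_draw i Ah).
have H q' : (if reply C q' is Some (a, C') then
        run A nb_asked k m.+1 (rcons h a) C' else nb_asked m.+1 None)
    <= (if reply C q' is Some (a, C') then
        prog_mean (F a) nb_asked m.+1 C' else nb_asked m.+1 None).
  by case: reply => [[a C']|] //; apply: IH (follows_ask a Ah).
case: q A0 Ah => [|l|l|l i|l i] A0 Ah; try exact: H.
apply: ler_sum => v _; rewrite ler_wpM2l ?invr_ge0 //.
exact: IH (follows_ask v Ah).
Qed.

Lemma expected_queries_prog p (s : node G) :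
  (expected_queries (prog_action p) s <=
     (prog_mean p nb_asked 0 [set s]%SET)%:E)%E.
Proof.
apply: ge_ereal_sup => _ [k _ <-]; rewrite lee_fin.
exact: (run_asked_le s).
Qed.

Definition accept (E : pred (svec R)) (_ : nat) (o : option (svec R)) : R :=
  if o is Some x then (E x)%:R else 0.

Lemma pr_output_prog_ge p (s : node G) (E : pred (svec R)) :
  ((prog_mean p (accept E) 0 [set s]%SET)%:E <=
     pr_output (prog_action p) s E)%E.
Proof.
have [k kP] := run_prog p (accept E).
by rewrite -kP; apply: ereal_sup_ubound; exists k.
Qed.

Lemma pr_output_le1 A (s : node G) (E : pred (svec R)) :
  (pr_output A s E <= 1%:E)%E.
Proof.
apply: ge_ereal_sup => _ [k _ <-]; rewrite lee_fin.
apply: (run_le1 s) => m [x|] //.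
by case: (E x).
Qed.

End Semantics.
End Programs.

(** * Truncated walks and their distance to PageRank *)

Section StoppingLaw.
Context {R : realType}.
Variables (alpha : R) (G : digraph) (s : node G).
Hypothesis alpha01 : 0 < alpha < 1.
Hypothesis nd : no_dangling G.

(** The transition operator of the walk without decay, acting on test functions: this is the
    direction in which the mean of a program unfolds. *)
Definition step_mean (g : node G -> R) (v : node G) : R :=
  \sum_(w | Defs.arc v w) (outdeg v)%:R^-1 * g w.

Lemma outdeg_gt0 (v : node G) : (0 < outdeg v)%N.
Proof. by have [w vw] := nd v; apply/card_gt0P; exists w. Qed.

Lemma iter_step_mean_cst k a v : iter k step_mean (fun=> a) v = a.
Proof.
elim: k v => [|k IH] v //=; rewrite /step_mean.
under eq_bigr do rewrite IH.
rewrite sumr_const -/(outdeg v) -[_ *+ _]mulr_natl mulrA mulfV ?mul1r //.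
by rewrite pnatr_eq0 -lt0n outdeg_gt0.
Qed.

(** Duality: [walk_at] pushes the law of the walk forward, [step_mean] pulls the test function back,
    and each move contributes a factor 1 - alpha. *)
Lemma walk_at_mean k g : \sum_t walk_at alpha s k t * g t =
  (1 - alpha) ^+ k * iter k step_mean g s.
Proof.
elim: k g => [|k IH] g.
  rewrite expr0 mul1r (bigD1 s) //= eqxx mul1r big1 ?addr0 // => t /negbTE ->.
  by rewrite mul0r.
rewrite exprS iterSr -mulrA -IH big_distrr /=.
under eq_bigr do rewrite big_distrl /=.
rewrite (exchange_big_dep xpredT) //=; apply: eq_bigr => u _.
rewrite /step_mean !big_distrr /=; apply: eq_bigr => t _; ring.
Qed.

Lemma walk_at_ge0 k t : 0 <= walk_at alpha s k t.
Proof.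
have /andP[a0 a1] := alpha01.
elim: k t => [|k IH] t /=; first exact: ler0n.
apply: sumr_ge0 => u _; rewrite mulr_ge0 // mulr_ge0 ?invr_ge0 //; lra.
Qed.

Lemma walk_at_sum k : \sum_t walk_at alpha s k t = (1 - alpha) ^+ k.
Proof.
transitivity (\sum_t walk_at alpha s k t * 1).
  by apply: eq_bigr => t _; rewrite mulr1.
by rewrite walk_at_mean iter_step_mean_cst mulr1.
Qed.

Lemma walk_at_le k t : walk_at alpha s k t <= (1 - alpha) ^+ k.
Proof.
rewrite -walk_at_sum (bigD1 t) //= lerDl.
by apply: sumr_ge0 => u _; exact: walk_at_ge0.
Qed.

Local Notation partial t := (series (fun k => alpha * walk_at alpha s k t)).

Lemma partial_nondecreasing t :
  {homo partial t : n m / (n <= m)%N >-> (n <= m)%R}.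
Proof.
apply/nondecreasing_seqP => n; rewrite -subr_ge0 seriesSB.
by have /andP[a0 a1] := alpha01; rewrite mulr_ge0 ?walk_at_ge0 ?ltW.
Qed.

(** The mass stopping after exactly k moves is at most alpha (1 - alpha)^k = (1 - alpha)^k - (1 -
    alpha)^(k+1), which telescopes. *)
Lemma partial_le t L n : (L <= n)%N ->
  partial t n <= partial t L + ((1 - alpha) ^+ L - (1 - alpha) ^+ n).
Proof.
move=> /subnK <-; elim: (n - L)%N => [|k IH]; first by rewrite add0n subrr addr0.
have -> : partial t (k.+1 + L)%N =
    partial t (k + L)%N + alpha * walk_at alpha s (k + L)%N t.
  by rewrite addSn -[LHS](subrK (partial t (k + L)%N)) seriesSB addrC.
have := walk_at_le (k + L)%N t; have /andP[a0 a1] := alpha01 => h.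
have := ler_wpM2l (ltW a0) h; rewrite addSn exprS; lra.
Qed.

Lemma ppr_bounds t L :
  partial t L <= ppr alpha s t <= partial t L + (1 - alpha) ^+ L.
Proof.
have /andP[a0 a1] := alpha01.
have p0 n : 0 <= (1 - alpha) ^+ n by rewrite exprn_ge0 ?subr_ge0 ?ltW.
have ub n : (L <= n)%N -> partial t n <= partial t L + (1 - alpha) ^+ L.
  by move=> /(partial_le t) h; have := p0 n; lra.
(* [limn] is total, so convergence has to be proved before [ppr] can be compared with partial sums.
   Indices below L are bounded through [maxn L n] by monotonicity. *)
have cv : cvgn (partial t).
  apply: nondecreasing_is_cvgn; first exact: partial_nondecreasing.
  exists (partial t L + (1 - alpha) ^+ L) => _ [n _ <-].
  apply: le_trans (ub (maxn L n) (leq_maxl _ _)).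
  exact/partial_nondecreasing/leq_maxr.
apply/andP; split.
  by apply: (nondecreasing_cvgn_le (@partial_nondecreasing t)).
apply: limr_le => //; exists L => // n /= Ln; exact: ub.
Qed.

(* Law of the end point of the walk that is stopped after at most L moves. *)
Definition stop_law (L : nat) (t : node G) : R :=
  \sum_(k < L) alpha * walk_at alpha s k t + walk_at alpha s L t.

Lemma stop_law_ge0 L t : 0 <= stop_law L t.
Proof.
have /andP[a0 _] := alpha01.
rewrite addr_ge0 ?walk_at_ge0 // sumr_ge0 // => k _.
by rewrite mulr_ge0 ?walk_at_ge0 ?ltW.
Qed.

(** Both quantities lie between the L-th partial sum and that sum plus (1 - alpha)^L. *)
Lemma stop_law_near_ppr L t :
  `|stop_law L t - ppr alpha s t| <= (1 - alpha) ^+ L.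
Proof.
have := ppr_bounds t L; rewrite /series /= big_mkord => /andP[lb ub].
have := walk_at_le L t; have := walk_at_ge0 L t => w0 w1.
rewrite /stop_law ler_norml; apply/andP; split; lra.
Qed.

Lemma ppr_le1 t : ppr alpha s t <= 1.
Proof.
by have /andP[_] := ppr_bounds t 0; rewrite seriesEnat /= big_geq // add0r.
Qed.

(** A walk ending away from s has survived its first stopping trial. *)
Lemma ppr_le_other t : t != s -> ppr alpha s t <= 1 - alpha.
Proof.
move=> /negbTE ts; have /andP[_] := ppr_bounds t 1.
by rewrite seriesEnat /= big_nat1 /= ts mulr0 add0r expr1.
Qed.

End StoppingLaw.

(** * The sampling program, its output law and its cost *)

Section Sampling.
Context {R : realType}.
Variable alpha : R.
Hypothesis alpha01 : 0 < alpha < 1.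

(** The whole tail mass of the geometric law is put on L. *)
Definition length_weight (L : nat) (l : 'I_L.+1) : R :=
  if (l < L)%N then alpha * (1 - alpha) ^+ l else (1 - alpha) ^+ L.

Lemma length_weight_ge0 L l : 0 <= @length_weight L l.
Proof.
have /andP[a0 a1] := alpha01.
by rewrite /length_weight; case: ifP; rewrite ?mulr_ge0 ?exprn_ge0 ?subr_ge0 ?ltW.
Qed.

Lemma sum_length_weight L (g : nat -> R) : \sum_l @length_weight L l * g l =
  \sum_(l < L) alpha * (1 - alpha) ^+ l * g l + (1 - alpha) ^+ L * g L.
Proof.
rewrite big_ord_recr /= /length_weight /= ltnn; congr (_ + _).
by apply: eq_bigr => l _; rewrite /= ltn_ord.
Qed.

Lemma length_weight_sum1 L : \sum_l @length_weight L l = 1.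
Proof.
under eq_bigr do rewrite -[length_weight _]mulr1.
rewrite (sum_length_weight L (fun=> 1)) mulr1.
elim: L => [|L IH]; first by rewrite big_ord0 add0r.
by rewrite big_ord_recr -[RHS]IH /= exprS; ring.
Qed.

Definition length_law L : fdist R L.+1 :=
  FDist (@length_weight_ge0 L) (@length_weight_sum1 L).

(** Induction on L gives the exact mean, which stays below the mean (1 - alpha)/alpha of the full
    geometric law. *)
Lemma length_law_mean_le L : \sum_l length_law L l * l%:R <= alpha^-1.
Proof.
have /andP[a0 a1] := alpha01.
have -> : \sum_l length_law L l * l%:R =
    (1 - alpha) * (1 - (1 - alpha) ^+ L) / alpha.
  rewrite (sum_length_weight L (fun l => l%:R)).
  elim: L => [|L IH]; first by rewrite big_ord0 expr0; ring.
  move: IH; rewrite big_ord_recr /= => IH.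
  rewrite -[X in X + _ + _](addrK ((1 - alpha) ^+ L * L%:R)) IH exprS -natr1.
  by field; rewrite gt_eqF.
rewrite ler_pdivrMr // mulVf ?gt_eqF //.
have p0 : 0 <= (1 - alpha) ^+ L by rewrite exprn_ge0 // subr_ge0 ltW.
have p1 : (1 - alpha) ^+ L <= 1 by rewrite exprn_ile1 // ?subr_ge0 ?gerBl ltW.
nra.
Qed.

Lemma uniform_ge0 d (i : 'I_d.+1) : 0 <= d.+1%:R^-1 :> R.
Proof. by rewrite invr_ge0. Qed.

Lemma uniform_sum1 d : \sum_(i < d.+1) d.+1%:R^-1 = 1 :> R.
Proof. by rewrite sumr_const card_ord -[_ *+ _]mulr_natl mulfV // pnatr_eq0. Qed.

Definition uniform d : fdist R d.+1 := FDist (@uniform_ge0 d) (uniform_sum1 d).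

(** Continuation-passing style: K receives the label of the end point. Out-degree 0 is treated apart
    because [uniform] needs a nonempty range. *)
Fixpoint walk_prog (l v : nat) (K : nat -> prog R) : prog R :=
  if l is l'.+1 then
    PAsk (OUTDEG v) (fun d =>
      if d is d'.+1 then
        PDraw (uniform d') (fun i =>
          PAsk (ADJout v i) (fun w => walk_prog l' w K))
      else K v)
  else K v.

Fixpoint walks_prog (L n s : nat) (K : seq nat -> prog R) : prog R :=
  if n is n'.+1 then
    PDraw (length_law L) (fun l =>
      walk_prog l s (fun w => walks_prog L n' s (fun ws => K (w :: ws))))
  else K [::].

Definition frequencies (n : nat) (ws : seq nat) : svec R :=
  [fsfun l in [fset l in ws]%fset => (count_mem l ws)%:R / n%:R].

Lemma frequenciesE n ws l : frequencies n ws l = (count_mem l ws)%:R / n%:R.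
Proof.
rewrite /frequencies fsfunE inE /=; case: ifP => // lws.
by rewrite (count_memPn _) ?mul0r // lws.
Qed.

Lemma frequencies_val k n (ws : seq 'I_k) t :
  frequencies n (map val ws) (val t) = (count_mem t ws)%:R / n%:R.
Proof.
rewrite frequenciesE count_map.
by congr (_%:R / _); apply: eq_count => u; rewrite /= val_eqE.
Qed.

Definition monte_carlo (L n s : nat) : prog R :=
  walks_prog L n s (fun ws => Ret (frequencies n ws)).

Variables (G : digraph) (s : node G).
Hypothesis nd : no_dangling G.
Implicit Types (C : {set node G}) (f : nat -> option (svec R) -> R).

Lemma covered_nodeE C v : v \in C -> covered_node C (val v) = Some v.
Proof.
rewrite /covered_node; case: pickP => [u /andP[_ /eqP/val_inj ->] //|/(_ v)].
by rewrite eqxx andbT => ->.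
Qed.

(** Each move costs one [OUTDEG] and one [ADJout], hence [m + l.*2]. The inclusion of C in C' keeps
    s covered for the next walk. *)
Lemma walk_prog_mean l v K f m C g : v \in C ->
  (forall w C', w \in C' -> C \subset C' ->
     prog_mean (K (val w)) f (m + l.*2) C' = g w) ->
  prog_mean (walk_prog l (val v) K) f m C = iter l (@step_mean R G) g v.
Proof.
elim: l v m C => [|l IH] v m C vC Kg; first by rewrite /= -(Kg v C) ?addn0.
rewrite [LHS]/= covered_nodeE //=.
have sz : size (out_nbrs v) = outdeg v.
  by rewrite (perm_size (out_nbrsP v)) -cardE.
rewrite /step_mean.
(* The program draws an arc index, so the sum over out-neighbours is reindexed by positions in
   [out_nbrs v]. *)
have -> : \sum_(w | Defs.arc v w) (outdeg v)%:R^-1 * iter l (@step_mean R G) g w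
    = \sum_(w <- out_nbrs v) (outdeg v)%:R^-1 * iter l (@step_mean R G) g w.
  by rewrite (perm_big _ (out_nbrsP v)) big_enum.
rewrite (big_nth v) big_mkord sz.
have := outdeg_gt0 nd v; case E : (outdeg v) => [//|d] _.
rewrite /=; apply: eq_bigr => i _; congr (_ * _).
rewrite covered_nodeE //=.
have -> : onth (out_nbrs v) i = Some (nth v (out_nbrs v) i).
  by rewrite onthE (nth_map v) // sz E.
rewrite /=; apply: IH; first by rewrite setU11.
move=> w C' wC' CC'; rewrite -(Kg w C' wC').
  by rewrite doubleS !addnS !addSn.
by apply: fintype.subset_trans CC'; exact: finset.subsetUr.
Qed.

(** By [walk_at_mean], mixing the iterates of [step_mean] over the random length amounts to
    averaging against [stop_law]. *)
Lemma walks_prog_mean L n K f F m C : s \in C ->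
  (forall ws m' C', prog_mean (K (map val ws)) f m' C' = F ws) ->
  prog_mean (walks_prog L n (val s) K) f m C =
  iid_mean (stop_law alpha s L) n F.
Proof.
elim: n K F m C => [|n IH] K F m C sC KF; first exact: (KF [::]).
rewrite /=; pose g w := iid_mean (stop_law alpha s L) n (fun ws => F (w :: ws)).
transitivity (\sum_(l < L.+1) length_weight l * iter l (@step_mean R G) g s).
  apply: eq_bigr => l _; congr (_ * _); apply: walk_prog_mean => // w C' _ CC'.
  apply: IH => [|ws m' C'']; first exact: (fintype.subsetP CC').
  exact: (KF (w :: ws)).
rewrite (sum_length_weight L (fun l => iter l (@step_mean R G) g s)).
under [RHS]eq_bigr do rewrite /stop_law mulrDl.
rewrite big_split /= walk_at_mean; congr (_ + _).
under [RHS]eq_bigr do rewrite big_distrl /=.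
rewrite exchange_big /=; apply: eq_bigr => k _.
rewrite -mulrA -walk_at_mean big_distrr /=.
by apply: eq_bigr => t _; rewrite mulrA.
Qed.

(** A walk of l moves asks exactly 2l queries wherever it goes, so [step_mean] acts on a
    constant. *)
Lemma walks_prog_asked L n K m C : s \in C ->
  (forall ws m' C', prog_mean (K ws) (@nb_asked R) m' C' = m'%:R) ->
  prog_mean (walks_prog L n (val s) K) (@nb_asked R) m C =
  m%:R + 2 * n%:R * \sum_l length_law L l * l%:R.
Proof.
set mu := \sum_l _.
elim: n K m C => [|n IH] K m C sC Km; first by rewrite /= Km; ring.
rewrite /=.
transitivity (\sum_(l < L.+1) (length_law L l * (m%:R + 2 * n%:R * mu) +
   2 * (length_law L l * l%:R))).
  apply: eq_bigr => l _.
  rewrite (@walk_prog_mean _ s _ _ _ _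
    (fun=> (m + l.*2)%:R + 2 * n%:R * mu)) //.
    by rewrite iter_step_mean_cst // natrD -muln2 natrM /=; ring.
  by move=> w C' _ CC'; apply: IH => //; exact: (fintype.subsetP CC').
rewrite big_split /= -big_distrl /= -big_distrr /= -/mu length_weight_sum1 -natr1.
ring.
Qed.

Lemma expected_queries_monte_carlo L n :
  (expected_queries (prog_action (monte_carlo L n (val s))) s <=
    (2 * n%:R / alpha)%:E)%E.
Proof.
apply: (le_trans (expected_queries_prog _ _)); rewrite lee_fin.
rewrite walks_prog_asked ?inE // add0r; apply: ler_wpM2l.
  by rewrite mulr_ge0.
exact: length_law_mean_le.
Qed.

Lemma stop_law_sum1 L : \sum_t stop_law alpha s L t = 1.
Proof.
rewrite big_split exchange_big /= walk_at_sum // -[RHS](length_weight_sum1 L).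
under [RHS]eq_bigr do rewrite -[length_weight _]mulr1.
rewrite (sum_length_weight L (fun=> 1)) mulr1; congr (_ + _).
by apply: eq_bigr => k _; rewrite mulr1 -big_distrr /= walk_at_sum.
Qed.

(** Reduces both guarantees to bounding one bad event for independent draws from [stop_law], with no
    further mention of programs. *)
Lemma monte_carlo_solves (c pf : R) Q L n (bad : seq (node G) -> bool) :
  (forall ws, ~~ bad ws ->
     ssppr_correct alpha c Q s (frequencies n (map val ws))) ->
  iid_mean (stop_law alpha s L) n (fun ws => (bad ws)%:R) <= pf ->
  solves alpha c pf Q s (prog_action (monte_carlo L n (val s))).
Proof.
move=> good bad_le.
have q0 := stop_law_ge0 s alpha01 L; have q1 := stop_law_sum1 L.
have mcE (E : pred (svec R)) :
    prog_mean (monte_carlo L n (val s)) (accept E) 0 [set s]%SET =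
    iid_mean (stop_law alpha s L) n
      (fun ws => (E (frequencies n (map val ws)))%:R).
  by apply: walks_prog_mean; rewrite ?inE.
split.
  apply/eqP; rewrite eq_le pr_output_le1 /=.
  by apply: le_trans (pr_output_prog_ge _ _ _); rewrite mcE iid_mean_cst.
apply: le_trans (pr_output_prog_ge _ _ _); rewrite lee_fin mcE.
apply: (@le_trans _ _ (1 - iid_mean (stop_law alpha s L) n
  (fun ws => (bad ws)%:R))); first by rewrite lerD2l lerN2.
rewrite lerBlDr -{1}(iid_mean_cst q1 n 1) -iid_meanD.
apply: ler_iid_mean => // ws; case E: (bad ws) => /=.
  by rewrite lerDr.
by rewrite good ?E // addr0.
Qed.

End Sampling.

(** * Choice of the parameters and the resulting guarantees *)

Section Guarantees.
Context {R : realType}.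
Variables alpha c pf : R.
Hypothesis alpha01 : 0 < alpha < 1.
Hypothesis c02 : 0 < c < 2^-1.
Hypothesis pf01 : 0 < pf < 1.

(** Having [0 < eta] under the existential makes [truncation_length] a total function. L may be
    picked by choice, as the query bound 2n/alpha does not depend on it. *)
Lemma truncation_length_exists (eta : R) :
  exists L, 0 < eta -> (1 - alpha) ^+ L <= eta.
Proof.
have /andP[a0 a1] := alpha01.
have [e0|] := ltP 0 eta; last by exists 0.
have : `|1 - alpha| < 1 by rewrite ger0_norm; lra.
move=> /cvg_expr /cvgrPdist_le /(_ _ e0) [L _ /(_ L (leqnn _)) H].
exists L => _; apply: le_trans H; rewrite /= sub0r normrN; exact: ler_norm.
Qed.

Definition truncation_length (eta : R) : nat :=
  projT1 (cid (truncation_length_exists eta)).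

Lemma truncation_lengthP eta : 0 < eta ->
  (1 - alpha) ^+ truncation_length eta <= eta.
Proof. exact: projT2 (cid (truncation_length_exists eta)). Qed.

Definition nb_walks (x : R) : nat := (Num.trunc x).+1.

Lemma nb_walks_bounds x : 0 <= x -> x <= (nb_walks x)%:R <= x + 1.
Proof.
move=> x0; rewrite ltW ?truncnS_gt //= /nb_walks -natr1 lerD2r.
by rewrite truncn_le.
Qed.

Section FixedGraph.
Variables (G : digraph) (s : node G).
Hypothesis nd : no_dangling G.

(** Chosen so that the bound 1/(n (eps/2)^2) of [second_moment_tail] is at most pf; the other eps/2
    is left to truncation. *)
Definition nb_walks_A (eps : R) := nb_walks (4 / (pf * eps ^+ 2)).

Lemma solves_A eps : 0 < eps < 1 ->
  solves alpha c pf (SSPPR_A eps) s (prog_action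
    (monte_carlo alpha01 (truncation_length (eps / 2)) (nb_walks_A eps) (val s))).
Proof.
move=> /andP[e0 e1]; have /andP[p0 p1] := pf01.
have e20 : 0 < eps / 2 by rewrite divr_gt0.
have n_ge : 4 / (pf * eps ^+ 2) <= (nb_walks_A eps)%:R.
  have /nb_walks_bounds /andP[//] : 0 <= 4 / (pf * eps ^+ 2).
  by rewrite divr_ge0 // mulr_ge0 ?exprn_ge0 ?ltW.
set L := truncation_length _; set n := nb_walks_A eps in n_ge *.
have n0 : 0 < n%:R :> R by rewrite ltr0n.
apply: (@monte_carlo_solves _ _ alpha01 _ _ nd _ _ _ _ _ (fun ws =>
  [exists t, eps / 2 < `|(count_mem t ws)%:R / n%:R - stop_law alpha s L t|])).
  move=> ws /existsPn H; apply/forallP => t.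
  rewrite frequencies_val.
  have := H t; rewrite -leNgt => h1.
  have h2 := le_trans (stop_law_near_ppr s alpha01 nd L t)
    (truncation_lengthP e20).
  apply: (le_trans (ler_distD (stop_law alpha s L t) _ _)).
  lra.
apply: (le_trans (second_moment_tail (stop_law_ge0 s alpha01 L)
  (stop_law_sum1 alpha s nd L) _ e20)) => //.
have -> : n%:R * (eps / 2) ^+ 2 = n%:R * eps ^+ 2 / 4 by field.
have e2 : 0 < eps ^+ 2 by rewrite exprn_gt0.
rewrite -[leLHS]div1r ler_pdivrMr ?divr_gt0 ?mulr_gt0 //.
move: n_ge; rewrite ler_pdivrMr ?mulr_gt0 //; lra.
Qed.

Lemma queries_A eps : 0 < eps < 1 ->
  (expected_queries (prog_action
    (monte_carlo alpha01 (truncation_length (eps / 2)) (nb_walks_A eps)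
      (val s))) s
   <= (2 * (4 / pf + 1) / alpha * (1 / eps ^+ 2))%:E)%E.
Proof.
move=> /andP[e0 e1]; have /andP[p0 p1] := pf01; have /andP[a0 a1] := alpha01.
have e2 : 0 < eps ^+ 2 by rewrite exprn_gt0.
apply: (le_trans (expected_queries_monte_carlo _ _ nd _ _)); rewrite lee_fin.
have n_le : (nb_walks_A eps)%:R <= 4 / (pf * eps ^+ 2) + 1.
  have /nb_walks_bounds /andP[//] : 0 <= 4 / (pf * eps ^+ 2).
  by rewrite divr_ge0 // mulr_ge0 ?ltW.
have -> : 2 * (4 / pf + 1) / alpha * (1 / eps ^+ 2) =
  2 * (4 / (pf * eps ^+ 2) + 1 / eps ^+ 2) / alpha by field; rewrite !gt_eqF.
rewrite ler_pM2r ?invr_gt0 // ler_pM2l //; apply: (le_trans n_le).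
(* The rounding term 1 is absorbed by 1/eps^2 >= 1. *)
by rewrite lerD2l ler_pdivlMr // mul1r exprn_ile1 // ltW.
Qed.

(* As [delta] tends to 1 the budget log(1/delta)/delta vanishes, so the
   algorithm must then answer without any query; the only node that can have
   [ppr >= delta] is s, where the guess 1 is accurate enough. *)
Definition trivial_threshold : R := Num.max (1 + c)^-1 (1 - alpha / 2).

Lemma trivial_threshold_bounds : 0 < trivial_threshold < 1.
Proof.
have /andP[a0 a1] := alpha01; have /andP[c0 c2] := c02.
rewrite lt_max gt_max invr_gt0 invf_lt1; lra.
Qed.

(** The bound (1 + c)^-1 <= [ppr] at s makes the guess 1 accurate, and 1 - alpha/2 > 1 - alpha
    excludes all other nodes. *)
Lemma solves_trivial delta : trivial_threshold <= delta ->
  solves alpha c pf (SSPPR_R delta) s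
    (prog_action (Ret (frequencies 1 [:: val s]))).
Proof.
have /andP[a0 a1] := alpha01; have /andP[c0 c2] := c02; have /andP[p0 p1] := pf01.
rewrite ge_max => /andP[dc da].
have cor : ssppr_correct alpha c (SSPPR_R delta) s (frequencies 1 [:: val s]).
  apply/forallP => t; apply/implyP => dt.
  have [ts|ts] := eqVneq t s; last first.
    have := ppr_le_other alpha01 nd ts; lra.
  rewrite frequenciesE ts /= eqxx addn0 divr1 mulr1n.
  rewrite ger0_norm ?subr_ge0 ?ppr_le1 //.
  have := le_trans dc dt; rewrite ts -[X in X <= _ -> _]div1r ler_pdivrMr; lra.
split.
  apply/eqP; rewrite eq_le pr_output_le1 andTb.
  by apply: le_trans (pr_output_prog_ge _ _ _).
apply: le_trans (pr_output_prog_ge _ _ _).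
by rewrite lee_fin /prog_mean /accept cor mulr1n gerBl ltW.
Qed.

(** [relative_tail] is used with b = delta/2 and a = c/3: its exponent is n delta c^2/144 and its
    prefactor 4/delta. *)
Definition nb_walks_R (delta : R) :=
  nb_walks (144 / (delta * c ^+ 2) * ln (4 / (pf * delta))).

Lemma nb_walks_R_bounds delta : 0 < delta < 1 ->
  144 / (delta * c ^+ 2) * ln (4 / (pf * delta)) <= (nb_walks_R delta)%:R <=
  144 / (delta * c ^+ 2) * ln (4 / (pf * delta)) + 1.
Proof.
move=> /andP[d0 d1]; have /andP[p0 p1] := pf01; have /andP[c0 _] := c02.
apply: nb_walks_bounds; rewrite mulr_ge0 //.
  by rewrite divr_ge0 // mulr_ge0 ?exprn_ge0 // ltW.
rewrite ln_ge0 // ler_pdivlMr ?mulr_gt0 // mul1r; nra.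
Qed.

(** With p = [ppr] >= delta and q = [stop_law], truncation costs at most (c/3) p, so q >= delta/2
    and q <= (1 + c/3) p. Sampling adds (c/3) q, and c/3 + (c/3)(1 + c/3) <= c. *)
Lemma solves_R delta : 0 < delta < 1 ->
  solves alpha c pf (SSPPR_R delta) s (prog_action
    (monte_carlo alpha01 (truncation_length (c * delta / 3))
      (nb_walks_R delta) (val s))).
Proof.
move=> d01; have /andP[n_ge _] := nb_walks_R_bounds d01.
have /andP[d0 d1] := d01.
have /andP[p0 p1] := pf01; have /andP[c0 c2] := c02.
have eta0 : 0 < c * delta / 3 by rewrite divr_gt0 // mulr_gt0.
set L := truncation_length _; set n := nb_walks_R delta in n_ge *.
have n0 : 0 < n%:R :> R by rewrite ltr0n.
apply: (@monte_carlo_solves _ _ alpha01 _ _ nd _ _ _ _ _ (fun ws =>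
  [exists (t | delta / 2 <= stop_law alpha s L t),
    c / 3 * stop_law alpha s L t <
      `|(count_mem t ws)%:R / n%:R - stop_law alpha s L t|])).
  move=> ws /existsPn H; apply/forallP => t; apply/implyP => dt.
  rewrite frequencies_val.
  have := le_trans (stop_law_near_ppr s alpha01 nd L t) (truncation_lengthP eta0).
  have := H t; move: dt.
  set p := ppr alpha s t; set q := stop_law alpha s L t.
  move=> dt Ht h2; have {}h2 : `|q - p| <= c / 3 * p.
    by apply: (le_trans h2); have := ler_wpM2l (ltW c0) dt; lra.
  have /andP[q1 q2] : (1 - c / 3) * p <= q <= (1 + c / 3) * p.
    by move: h2; rewrite ler_norml => /andP[]; lra.
  have dq : delta / 2 <= q by nra.
  move: Ht; rewrite dq /= -leNgt => h1.
  apply: (le_trans (ler_distD q _ _)); nra.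
apply: (le_trans (relative_tail (stop_law_ge0 s alpha01 L)
  (stop_law_sum1 alpha s nd L) _ _ _)) => //; [lra|lra|].
rewrite -[_ / _ * _]mulrC -ler_pdivlMr ?divr_gt0 //.
have -> : pf / (2 / (delta / 2)) = (4 / (pf * delta))^-1.
  by field; rewrite !gt_eqF.
rewrite expRN lef_pV2 ?posrE ?expR_gt0 ?divr_gt0 ?mulr_gt0 //.
rewrite -[leLHS]lnK ?posrE ?divr_gt0 ?mulr_gt0 // ler_expR.
have -> : n%:R * (delta / 2) * (c / 3) ^+ 2 / 8 =
    n%:R * (delta * c ^+ 2) / 144 by field.
move: n_ge; rewrite mulrAC ler_pdivrMr ?mulr_gt0 ?exprn_gt0 //; lra.
Qed.

(** Below the threshold, ln(1/delta) is at least l = ln(1/[trivial_threshold]) > 0, so [ln (4 / pf)]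
    and the rounding term 1 are absorbed at the price of a factor 1/l. *)
Definition queries_R_constant : R :=
  2 * (144 / c ^+ 2 * (ln (4 / pf) / ln (1 / trivial_threshold) + 1) +
       1 / ln (1 / trivial_threshold)) / alpha.

Lemma ln_threshold_gt0 : 0 < ln (1 / trivial_threshold).
Proof.
have /andP[t0 t1] := trivial_threshold_bounds.
by rewrite ln_gt0 // ltr_pdivlMr // mul1r.
Qed.

Lemma queries_R_constant_gt0 : 0 < queries_R_constant.
Proof.
have /andP[a0 a1] := alpha01; have /andP[c0 _] := c02; have /andP[p0 p1] := pf01.
have l0 := ln_threshold_gt0.
have lp : 0 <= ln (4 / pf) by rewrite ln_ge0 // ler_pdivlMr //; lra.
rewrite divr_gt0 // mulr_gt0 // addr_gt0 ?divr_gt0 //.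
rewrite mulr_gt0 ?divr_gt0 ?exprn_gt0 //.
by rewrite ltr_wpDl // divr_ge0 // ltW.
Qed.

Lemma queries_R delta : 0 < delta -> delta < trivial_threshold ->
  (expected_queries (prog_action
    (monte_carlo alpha01 (truncation_length (c * delta / 3))
      (nb_walks_R delta) (val s))) s
   <= (queries_R_constant * (ln (1 / delta) / delta))%:E)%E.
Proof.
move=> d0 dt.
have /andP[t0 t1] := trivial_threshold_bounds.
have d1 : delta < 1 by lra.
have /andP[a0 a1] := alpha01; have /andP[c0 _] := c02; have /andP[p0 p1] := pf01.
apply: (le_trans (expected_queries_monte_carlo _ _ nd _ _)); rewrite lee_fin.
have /andP[_ n_le] := @nb_walks_R_bounds delta ltac:(lra).
rewrite /queries_R_constant [leRHS]mulrAC ler_pM2r ?invr_gt0 //.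
rewrite -(mulrA 2) ler_pM2l //.
apply: (le_trans n_le).
have -> : ln (4 / (pf * delta)) = ln (4 / pf) + ln (1 / delta).
  rewrite -lnM ?posrE ?divr_gt0 //; congr ln; field.
  by rewrite !gt_eqF.
have l0 := ln_threshold_gt0; set l := ln (1 / trivial_threshold) in l0 *.
have ll : l <= ln (1 / delta).
  by rewrite ler_ln ?posrE ?divr_gt0 // !div1r lef_pV2 ?posrE // ltW.
set x := ln (1 / delta) in ll *.
have lp : 0 <= ln (4 / pf) by rewrite ln_ge0 // ler_pdivlMr //; lra.
have xl : 1 <= x / l by rewrite ler_pdivlMr // mul1r.
have c2 : 0 < c ^+ 2 by rewrite exprn_gt0.
have -> : (144 / c ^+ 2 * (ln (4 / pf) / l + 1) + 1 / l) * (x / delta) =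
  144 / (delta * c ^+ 2) * (ln (4 / pf) * (x / l) + x) + x / l / delta.
  by field; rewrite !gt_eqF.
apply: lerD.
  apply: ler_wpM2l; first by rewrite divr_ge0 // ltW // mulr_gt0.
  by rewrite lerD2r ler_peMr.
rewrite ler_pdivlMr // mul1r; lra.
Qed.

End FixedGraph.
End Guarantees.

Theorem theorem1p5 (R : realType) (alpha c pf : R) :
  0 < alpha < 1 -> 0 < c < 2^-1 -> 0 < pf < 1 ->
  exists RoundWalks : ssppr_query R -> nat -> algorithm R,
    (exists2 C : R, 0 < C &
       forall (G : digraph) (s : node G) (eps : R),
         no_dangling G -> 0 < eps < 1 ->
         solves alpha c pf (SSPPR_A eps) s (RoundWalks (SSPPR_A eps) (val s)) /\
         (expected_queries (RoundWalks (SSPPR_A eps) (val s)) s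
            <= (C * (1 / eps ^+ 2))%:E)%E)
    /\
    (exists2 C : R, 0 < C &
       forall (G : digraph) (s : node G) (delta : R),
         no_dangling G -> 0 < delta < 1 ->
         solves alpha c pf (SSPPR_R delta) s
           (RoundWalks (SSPPR_R delta) (val s)) /\
         (expected_queries (RoundWalks (SSPPR_R delta) (val s)) s
            <= (C * (ln (1 / delta) / delta))%:E)%E).
Proof.
move=> a01 c02 p01.
exists (fun Q s => prog_action
  match Q with
  | SSPPR_A eps => monte_carlo a01 (truncation_length a01 (eps / 2))
      (nb_walks_A pf eps) s
  | SSPPR_R delta =>
      if trivial_threshold alpha c <= delta then Ret (frequencies 1 [:: s])
      else monte_carlo a01 (truncation_length a01 (c * delta / 3))
        (nb_walks_R c pf delta) s
  end).
split.
  exists (2 * (4 / pf + 1) / alpha) => [|G s eps nd e01]; last first.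
    by split; [exact: solves_A | exact: queries_A].
  have /andP[a0 _] := a01; have /andP[p0 _] := p01.
  by rewrite divr_gt0 // mulr_gt0 // addr_gt0 // divr_gt0.
exists (queries_R_constant alpha c pf) => [|G s delta nd /andP[d0 d1]].
  exact: queries_R_constant_gt0.
case: leP => [td|dt]; last first.
  by split; [apply: solves_R => //; rewrite d0 | exact: queries_R].
split; first exact: solves_trivial.
(* [Ret] asks nothing, so only the sign of the bound matters. *)
apply: (le_trans (expected_queries_prog _ _)); rewrite lee_fin /nb_asked /=.
rewrite mulr_ge0 ?ltW ?queries_R_constant_gt0 // divr_gt0 // ln_gt0 //.
by rewrite ltr_pdivlMr // mul1r.
Qed.
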